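(* Let $\mathbf{M}^*=\sigma_1\mathbf{u}^*\mathbf{v}^{*\top}\in\mathbb{R}^{d_1\times d_2}$ where $\mathbf{u}^*\in\mathbb{R}^{d_1}$, $\mathbf{v}^*\in\mathbb{R}^{d_2}$ are unit vectors and $\sigma_1>0$, and let $d=\max\{d_1,d_2\}$. Consider gradient descent for $\min_{\mathbf{u},\mathbf{v}}\frac12\|\mathbf{u}\mathbf{v}^\top-\mathbf{M}^*\|_F^2$: $$\mathbf{u}_{t+1}=\mathbf{u}_t-\eta(\mathbf{u}_t\mathbf{v}_t^\top-\mathbf{M}^* )\mathbf{v}_t,\qquad \mathbf{v}_{t+1}=\mathbf{v}_t-\eta(\mathbf{v}_t\mathbf{u}_t^\top-\mathbf{M}^{*\top})\mathbf{u}_t,$$ with $\mathbf{u}_0\sim\mathcal{N}(\mathbf{0},\delta\mathbf{I})$, $\mathbf{v}_0\sim\mathcal{N}(\mathbf{0},\delta\mathbf{I})$, $\delta=c_{init}\sqrt{\sigma_1/d}$, and $\eta=c_{step}/\sigma_1$, where $c_{init}>0$ and $c_{step}>0$ are sufficiently small universal constants. Then with constant probability over the initialization, for all $t$ we have $c_0\le\frac{|\mathbf{u}_t^\top\mathbf{u}^*|}{|\mathbf{v}_t^\top\mathbf{v}^*|}\le C_0$ for some universal constants $c_0,C_0>0$. Furthermore, for any $0<\epsilon<1$, after $t=O(\log\frac{d}{\epsilon})$ iterations we have $\|\mathbf{u}_t\mathbf{v}_t^\top-\mathbf{M}^*\|_F\le\epsilon\sigma_1$.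
   Context: $\|\cdot\|_F$ is the Frobenius norm; $\mathbf{I}$ is the identity matrix of the appropriate dimension.
   Formalization: The entries of u_0 and v_0 are taken with standard deviation δ (covariance δ²I instead of δI, for which gradient descent diverges when d/σ_1 is large), and t = O(log(d/ε)) is read as t ≥ C(log(d/ε)+1). *)

(* Defs.v *)
From HB Require Import structures.
From mathcomp Require Import all_boot all_order all_algebra.
From mathcomp Require Import all_classical all_reals all_analysis.
Set Implicit Arguments. Unset Strict Implicit. Unset Printing Implicit Defensive.
Import Order.TTheory GRing.Theory Num.Theory.
Local Open Scope classical_set_scope.
Local Open Scope ring_scope.

Section Defs.
Variable R : realType.

Definition dotv n (x y : 'cV[R]_n) : R := (x^T *m y) 0 0.

Definition unit_vec n (x : 'cV[R]_n) : Prop := dotv x x = 1.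

Definition frob m n (A : 'M[R]_(m, n)) : R :=
  Num.sqrt (\sum_(i < m) \sum_(j < n) A i j ^+ 2).

Definition Mstar d1 d2 (sigma1 : R) (us : 'cV[R]_d1) (vs : 'cV[R]_d2)
  : 'M[R]_(d1, d2) := sigma1 *: (us *m vs^T).

(* one (simultaneous) gradient-descent step on 1/2 ||u v^T - M||_F^2 *)
Definition gd_step d1 d2 (eta : R) (M : 'M[R]_(d1, d2))
  (uv : 'cV[R]_d1 * 'cV[R]_d2) : 'cV[R]_d1 * 'cV[R]_d2 :=
  let: (u, v) := uv in
  (u - eta *: ((u *m v^T - M) *m v), v - eta *: ((v *m u^T - M^T) *m u)).

Definition gd_iter d1 d2 (eta : R) (M : 'M[R]_(d1, d2))
  (u0 : 'cV[R]_d1) (v0 : 'cV[R]_d2) (t : nat) : 'cV[R]_d1 * 'cV[R]_d2 :=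
  iter t (gd_step eta M) (u0, v0).

Definition mutually_independent {dT} {T : measurableType dT}
  (P : probability T R) (I : finType) (X : I -> T -> R) : Prop :=
  forall B : I -> set R, (forall i, measurable (B i)) ->
    P (\bigcap_(i in [set: I]) (X i @^-1` B i)) =
    (\prod_(i : I) P (X i @^-1` B i))%E.

Definition join_fam {T : Type} d1 d2 (X : 'I_d1 -> T -> R)
  (Y : 'I_d2 -> T -> R) : 'I_d1 + 'I_d2 -> T -> R :=
  fun k => match k with inl i => X i | inr j => Y j end.

End Defs.

(* Main.v *)
Require Import Defs.
From HB Require Import structures.
From mathcomp Require Import all_boot all_order all_algebra.
From mathcomp Require Import all_classical all_reals all_analysis.
From mathcomp Require Import measurable_realfun simple_functions.
From mathcomp Require Import measurable_fun_approximation normal_distribution.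
From mathcomp Require Import zify ring lra.
Set Implicit Arguments. Unset Strict Implicit. Unset Printing Implicit Defensive.
Import Order.TTheory GRing.Theory Num.Theory.
Local Open Scope classical_set_scope.
Local Open Scope ring_scope.

(** Rescale by [sqrt sigma1] and set [a = u^T u*], [b = v^T v*], [p = |u|^2 - a^2],
    [q = |v|^2 - b^2].  Gradient descent closes on these four numbers; [p] and [q] are
    nonincreasing, and the imbalance [D = |u|^2 - |v|^2] satisfies exactly
    [D' = (1 - c^2 F) D + c^2 (p - q)] with [F] the squared loss.  Either [F >= 1/4] and
    [D] contracts, or [|u|^2, |v|^2 >= 1/4] and [p + q] contracts, so [|D| + 4 c (p + q)]
    stays below [1/2] forever.  A bounded imbalance makes the cone [a <= 7 b, b <= 7 a]
    invariant, which is the ratio bound.  While [a b < 1/2], the sum [a + b] grows by the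
    factor [1 + c/4], so [O(log d)] steps suffice to reach [a b >= 1/2]; from then on
    [|1 - a b| + 16 (p + q)] decreases geometrically and dominates [F].

    For the initialization, let [A] and [B] be the standardized values of [a] and [b].
    Tilting the law by [exp (4 (A + B))] recentres both at [4], so that [1 <= A, B <= 7] and
    [|u|^2 + |v|^2 = O(delta^2 d)] hold with tilted probability at least [1/4] by Chernoff and
    Markov bounds; on this event the tilt is at most [exp 56].  Every estimate is the
    integral of the exponential of a linear form, i.e. a product of Gaussian moment
    generating functions. *)

(** * One step of the scalar dynamics *)

(* [a], [b] are the signal components and [p], [q] the squared norms of the orthogonal ones,
   in units where [sigma1 = 1]. *)
Definition basin (R : realFieldType) (c a b p q : R) : Prop :=
  let U := a ^+ 2 + p in let V := b ^+ 2 + q in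
  [/\ 0 < a /\ 0 < b, [/\ 0 <= p, 0 <= q & p + q <= 1 / 100],
      a <= 7 * b /\ b <= 7 * a,
      `|U - V| + 4 * c * (p + q) <= 1 / 2 & U + V <= 4].

Lemma sqr_contraction (R : realFieldType) (c V r : R) :
  0 <= c * V -> c * V <= 1 -> 0 <= r ->
  (1 - c * V) ^+ 2 * r <= (1 - c * V) * r.
Proof.
move=> h1 h2 r0; apply: ler_wpM2r => //.
have : 0 <= c * V * (1 - c * V) by apply: mulr_ge0 => //; lra.
by rewrite expr2; lra.
Qed.

(** Write [U], [V] for the two squared norms. Their product is at least [(a b)^2 >= 1/4]; if one
    were below [1/4], the other would be below [3/4], and the product below [3/16]. *)
Lemma min_ge_quarter (R : realFieldType) (a b p q : R) :
  0 < a -> 0 < b -> 0 <= p -> 0 <= q ->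
  `|a ^+ 2 + p - (b ^+ 2 + q)| <= 1 / 2 -> 1 / 2 <= a * b ->
  1 / 4 <= a ^+ 2 + p /\ 1 / 4 <= b ^+ 2 + q.
Proof.
move=> a0 b0 p0 q0 hD hab.
have hUV : 1 / 4 <= (a ^+ 2 + p) * (b ^+ 2 + q).
  have h1 : 1 / 4 <= (a * b) ^+ 2 by rewrite expr2; nra.
  have h2 : 0 <= a ^+ 2 * q + p * b ^+ 2 + p * q.
    by rewrite !addr_ge0 ?sqr_ge0 // mulr_ge0 ?sqr_ge0.
  by rewrite exprMn in h1; lra.
have U0 : 0 <= a ^+ 2 + p by rewrite addr_ge0 ?sqr_ge0.
have V0 : 0 <= b ^+ 2 + q by rewrite addr_ge0 ?sqr_ge0.
move: hD hUV U0 V0; set U := _ + p; set V := _ + q.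
rewrite ler_norml => /andP[h1 h2] hUV U0 V0.
by split; rewrite leNgt; apply/negP => h; nra.
Qed.

(** Three cases, with [w = p + q]. If [F >= 1/4] and [D >= 4 w], the contraction of [D] gains at
    least [c^2 D / 4], which pays for the drift [c^2 w]. If [F >= 1/4] and [D < 4 w], everything is
    far below [1/2]. If [F < 1/4], the term [4 c w] drops by [c^2 w], exactly the drift; this fixes
    the weight [4 c]. *)
Lemma imbalance_budget (R : realFieldType) (c D F p q p' q' : R) :
  0 < c -> c <= 1 / 100 -> 0 <= p -> 0 <= q -> p + q <= 1 / 100 ->
  0 <= D -> D + 4 * c * (p + q) <= 1 / 2 -> 0 <= F -> F <= 5 ->
  p' + q' <= p + q -> (F < 1 / 4 -> p' + q' <= (1 - c / 4) * (p + q)) ->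
  D * (1 - c ^+ 2 * F) + c ^+ 2 * (p + q) + 4 * c * (p' + q') <= 1 / 2.
Proof.
move=> c0 c1 p0 q0 w1 D0 hD F0 F5 hw hw2.
have w0 : 0 <= p + q by rewrite addr_ge0.
move: w0 w1 hD hw hw2; set w := p + q; set w' := p' + q' => w0 w1 hD hw hw2.
have c20 : 0 <= c ^+ 2 by rewrite sqr_ge0.
have cw : c * w' <= c * w by apply: ler_wpM2l => //; exact: ltW.
case: (lerP (1 / 4) F) => hF.
  have : 0 <= D * c ^+ 2 * (F - 1 / 4) by rewrite !mulr_ge0 //; lra.
  case: (lerP (4 * w) D) => hD4.
    have : 0 <= c ^+ 2 * (D - 4 * w) by rewrite mulr_ge0 //; lra.
    by lra.
  have : D * (1 - c ^+ 2 / 4) <= 4 * w * (1 - c ^+ 2 / 4).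
    by apply: ler_wpM2r; [rewrite expr2; nra|lra].
  have : c * w <= 1 / 100 * (1 / 100) by apply: ler_pM => //; exact: ltW.
  by lra.
have : c * w' <= c * ((1 - c / 4) * w) by apply: ler_wpM2l; [exact: ltW|exact: hw2].
have : 0 <= D * (c ^+ 2 * F) by rewrite mulr_ge0 // mulr_ge0.
by rewrite expr2; lra.
Qed.

Lemma half_le_of_sqr (R : realFieldType) (x : R) : (1 - x) ^+ 2 < 1 / 4 -> 1 / 2 <= x.
Proof. by rewrite expr2 => h; rewrite leNgt; apply/negP => hx; nra. Qed.

Section Step.
Variables (R : realFieldType) (c a b p q : R).
Hypotheses (c0 : 0 < c) (c1 : c <= 1 / 100).
Let U : R := a ^+ 2 + p.
Let V : R := b ^+ 2 + q.
Let a' : R := (1 - c * V) * a + c * b.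
Let b' : R := (1 - c * U) * b + c * a.
Let p' : R := (1 - c * V) ^+ 2 * p.
Let q' : R := (1 - c * U) ^+ 2 * q.
Hypothesis B : basin c a b p q.

Let bounds : [/\ 0 < c <= 1 / 100, 0 <= U /\ 0 <= V, U + V <= 4, 0 <= c * U <= 1 / 25 & 0 <= c * V <= 1 / 25].
Proof.
case: B => _ [p0 q0 w1] _ _; rewrite -/U -/V => hS.
have U0 : 0 <= U by rewrite addr_ge0 ?sqr_ge0.
have V0 : 0 <= V by rewrite addr_ge0 ?sqr_ge0.
have c00 : 0 <= c by exact: ltW.
have hU : c * U <= 1 / 100 * 4 by apply: ler_pM => //; lra.
have hV : c * V <= 1 / 100 * 4 by apply: ler_pM => //; lra.
by split; rewrite ?mulr_ge0 ?c0 ?c1 //=; lra.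
Qed.

Let imbalance_le : `|U - V| <= 1 / 2.
Proof.
case: B => _ [p0 q0 _] _; rewrite -/U -/V => hD _.
have : 0 <= c * (p + q) by rewrite mulr_ge0 ?addr_ge0 // ltW.
by lra.
Qed.

Lemma basin_perp_le : p' + q' <= p + q.
Proof.
case: bounds => /andP[cp cs] [U0 V0] _ /andP[u1 u2] /andP[v1 v2]; case: B => _ [p0 q0 w1] _ _ _.
have v3 : c * V <= 1 by lra.
have u3 : c * U <= 1 by lra.
have := sqr_contraction v1 v3 p0; have := sqr_contraction u1 u3 q0.
rewrite -/p' -/q'; nra.
Qed.

Lemma basin_perp_contraction : 1 / 2 <= a * b -> p' + q' <= (1 - c / 4) * (p + q).
Proof.
move=> hab.
case: bounds => /andP[cp cs] [U0 V0] _ /andP[u1 u2] /andP[v1 v2]; case: B => [[a0 b0]] [p0 q0 w1] _ hD _.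
have hD' : `|a ^+ 2 + p - (b ^+ 2 + q)| <= 1 / 2.
  exact: imbalance_le.
have [] := @min_ge_quarter _ a b p q a0 b0 p0 q0 hD' hab; rewrite -/U -/V => hU hV.
have v3 : c * V <= 1 by lra.
have u3 : c * U <= 1 by lra.
have := sqr_contraction v1 v3 p0; have := sqr_contraction u1 u3 q0.
have : 0 <= c * p * (V - 1 / 4) by rewrite !mulr_ge0 //; lra.
have : 0 <= c * q * (U - 1 / 4) by rewrite !mulr_ge0 //; lra.
rewrite -/p' -/q'; lra.
Qed.

Let F : R := U * V - 2 * (a * b) + 1.

(** The four terms are the squared norms of the error along the tensor products of the signal
    direction or its complement on each side; nonnegativity of [F] is read off from here. *)
Lemma loss_decomp :
  F = (1 - a * b) ^+ 2 + a ^+ 2 * q + p * b ^+ 2 + p * q.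
Proof. by rewrite /F /U /V; ring. Qed.

Let Fbounds : 0 <= F <= 5.
Proof.
case: bounds => /andP[cp cs] [U0 V0] hS _ _; case: B => [[a0 b0]] [p0 q0 w1] _ _ _.
apply/andP; split.
  by rewrite loss_decomp !addr_ge0 ?sqr_ge0 // mulr_ge0 ?sqr_ge0.
have : 0 < a * b by rewrite mulr_gt0.
have : U * V <= 4 by have := sqr_ge0 (U - V); rewrite expr2; nra.
by rewrite /F; lra.
Qed.

(* [F >= 0] is the squared loss, which is why the imbalance never grows on its own. *)
Lemma imbalance_step :
  (a' ^+ 2 + p') - (b' ^+ 2 + q') = (U - V) * (1 - c ^+ 2 * F) + c ^+ 2 * (p - q).
Proof. by rewrite /F /a' /b' /p' /q' /U /V; ring. Qed.

Lemma basin_imbalance :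
  `|(a' ^+ 2 + p') - (b' ^+ 2 + q')| + 4 * c * (p' + q') <= 1 / 2.
Proof.
rewrite imbalance_step.
have /andP[F0 F5] := Fbounds.
have [[a0 b0] [p0 q0 w1] _ hD _] := B.
have c20 : 0 <= c ^+ 2 by rewrite sqr_ge0.
apply: le_trans (imbalance_budget c0 c1 p0 q0 w1 (normr_ge0 (U - V)) hD F0 F5 basin_perp_le _).
  apply: lerD => //; apply: (le_trans (ler_normD _ _)).
  have hk : 0 <= 1 - c ^+ 2 * F.
    have c2 : c ^+ 2 <= 1 / 5.
      rewrite expr2 -[1 / 5]mul1r; apply: ler_pM; rewrite ?ltW //.
        by apply: le_lt_trans c1 _; lra.
      by apply: le_lt_trans c1 _; lra.
    by rewrite subr_ge0; apply: le_trans (ler_pM c20 F0 c2 F5) _; lra.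
  rewrite normrM (normrM (c ^+ 2)) (ger0_norm hk) (ger0_norm c20).
  apply: lerD => //; apply: ler_wpM2l => //.
  by rewrite -{2}(ger0_norm p0) -{2}(ger0_norm q0) ler_normB.
(* A loss below [1/4] forces [(1 - a b)^2 < 1/4], hence [a b >= 1/2], the regime where [p + q]
   contracts. *)
move=> hF; apply: basin_perp_contraction.
have h : 0 <= a ^+ 2 * q + p * b ^+ 2 + p * q.
  by rewrite !addr_ge0 ?sqr_ge0 // mulr_ge0 ?sqr_ge0.
have h2 : (1 - a * b) ^+ 2 < 1 / 4 by apply: le_lt_trans hF; rewrite loss_decomp -addrA -addrA lerDl addrA.
exact: half_le_of_sqr h2.
Qed.

(** With [S = U + V], the first-order change is [- 4 c (U V - a b)]. The small imbalance gives
    [4 U V >= S^2 - 1/4], and [2 a b <= S], so the decrease is at least [c (S^2 - 2 S - 1/4)]; the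
    second-order terms add at most [20 c^2 <= c / 5]. *)
Lemma basin_size : a' ^+ 2 + p' + (b' ^+ 2 + q') <= 4.
Proof.
case: bounds => /andP[cp cs] [U0 V0] hS _ _; case: B => [[a0 b0]] [p0 q0 w1] _ + _; rewrite -/U -/V => hD.
have hD' : `|U - V| <= 1 / 2.
  exact: imbalance_le.
have hD2 : (U - V) ^+ 2 <= 1 / 4.
  by have := imbalance_le; rewrite ler_norml expr2 => /andP[? ?]; nra.
have ab0 : 0 < a * b by rewrite mulr_gt0.
have abS : 2 * (a * b) <= U + V.
  by have := sqr_ge0 (a - b); rewrite /U /V; nra.
have -> : a' ^+ 2 + p' + (b' ^+ 2 + q') = U + V - 4 * c * (U * V - a * b) +
   c ^+ 2 * (V ^+ 2 * U - 2 * V * (a * b) + b ^+ 2 + (U ^+ 2 * V - 2 * U * (a * b) + a ^+ 2)).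
  by rewrite /a' /b' /p' /q' /U /V; ring.
have UV4 : U * V <= 4 by have := sqr_ge0 (U - V); rewrite expr2; nra.
have h1 : V ^+ 2 * U - 2 * V * (a * b) + b ^+ 2 + (U ^+ 2 * V - 2 * U * (a * b) + a ^+ 2) <= 20.
  have : 0 <= V * (a * b) by rewrite mulr_ge0 // ltW.
  have : 0 <= U * (a * b) by rewrite mulr_ge0 // ltW.
  have : (U * V) * (U + V) <= 4 * 4 by apply: ler_pM => //; [exact: mulr_ge0|exact: addr_ge0].
  have : a ^+ 2 + b ^+ 2 <= U + V by rewrite /U /V; lra.
  by rewrite !expr2; lra.
have h2 : c ^+ 2 * (V ^+ 2 * U - 2 * V * (a * b) + b ^+ 2 + (U ^+ 2 * V - 2 * U * (a * b) + a ^+ 2)) <= c * (1 / 5).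
  have : c ^+ 2 * (V ^+ 2 * U - 2 * V * (a * b) + b ^+ 2 + (U ^+ 2 * V - 2 * U * (a * b) + a ^+ 2)) <= c ^+ 2 * 20.
    by apply: ler_wpM2l => //; exact: sqr_ge0.
  by rewrite expr2; nra.
have UVE : 4 * (U * V) = (U + V) ^+ 2 - (U - V) ^+ 2 by ring.
have h3 : 4 * c * (U * V - a * b) >= c * ((U + V) ^+ 2 - 1 / 4 - 2 * (U + V)).
  rewrite (mulrC 4) -mulrA; apply: ler_wpM2l; first lra.
  by lra.
move: h2 h3 hS; set Q := c ^+ 2 * _; set S := U + V; set W := 4 * c * _ => h2 h3 hS.
(* Below [3], one step cannot climb as far as [4]; above [3], the first-order decrease is at least
   [c] and beats [c / 5]. *)
case: (lerP S 3) => hS3.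
  have h4 : c * ((S ^+ 2 - 1 / 4 - 2 * S)) >= c * (- (5/4)).
    by apply: ler_wpM2l; [lra|]; have := sqr_ge0 (S - 1); rewrite !expr2; lra.
  by lra.
have : c * ((S ^+ 2 - 1 / 4 - 2 * S)) >= c * 1.
  by apply: ler_wpM2l; [lra|]; rewrite expr2; nra.
lra.
Qed.

(** The gap [7 b' - a'] is a nonnegative multiple of [7 b - a] plus [c b (48 - 7 (U - V))], where
    [48 = 7^2 - 1]. The imbalance bound keeps the last factor positive, and the other gap is
    symmetric. *)
Lemma basin_ratio : a' <= 7 * b' /\ b' <= 7 * a'.
Proof.
case: bounds => /andP[cp cs] [U0 V0] hS /andP[u1 u2] /andP[v1 v2].
case: B => [[a0 b0]] [p0 q0 w1] [ab ba] + _; rewrite -/U -/V => hD.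
have := imbalance_le; rewrite ler_norml => /andP[hD1 hD2].
have -> : a' = 7 * b' - (7 * b - a) * (1 - c * V - 7 * c) - c * b * (48 - 7 * (U - V)).
  by rewrite /a' /b'; ring.
have h1 : 0 <= (7 * b - a) * (1 - c * V - 7 * c) by apply: mulr_ge0; lra.
have h2 : 0 <= c * b * (48 - 7 * (U - V)) by rewrite !mulr_ge0 //; lra.
split; first lra.
rewrite -subr_ge0.
have -> : 7 * (7 * b' - (7 * b - a) * (1 - c * V - 7 * c) - c * b * (48 - 7 * (U - V))) - b' =
 (7 * a - b) * (1 - c * U - 7 * c) + c * a * (48 + 7 * (U - V)).
  by rewrite /b'; ring.
by rewrite addr_ge0 // !mulr_ge0 //; lra.
Qed.

Lemma basin_pos : 0 < a' /\ 0 < b'.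
Proof.
case: bounds => /andP[cp cs] [U0 V0] hS /andP[u1 u2] /andP[v1 v2]; case: B => [[a0 b0]] _ _ _ _.
by split; apply: addr_gt0; rewrite mulr_gt0 //; lra.
Qed.

Lemma basin_step : basin c a' b' p' q'.
Proof.
case: (B) => _ [p0 q0 w1] _ _ _; split.
- exact: basin_pos.
- split; [by rewrite mulr_ge0 ?sqr_ge0..|exact: le_trans basin_perp_le w1].
- exact: basin_ratio.
- exact: basin_imbalance.
- exact: basin_size.
Qed.

(** The exact increment is [c (1 - a b) (a + b)], at least [c (a + b) / 2], minus a leakage
    [c (q a + p b)], at most [c (a + b) / 100]. *)
Lemma sum_growth : a * b <= 1 / 2 -> (1 + c / 4) * (a + b) <= a' + b'.
Proof.
move=> hab; case: bounds => /andP[cp cs] _ _ _ _; case: B => [[a0 b0]] [p0 q0 w1] _ _ _.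
have -> : a' + b' = (a + b) * (1 + c * (1 - a * b)) - c * (q * a + p * b).
  by rewrite /a' /b' /U /V; ring.
have h1 : q * a + p * b <= 1 / 100 * (a + b) by nra.
have h2 : c * (q * a + p * b) <= c * (1 / 100 * (a + b)) by apply: ler_wpM2l => //; lra.
have h3 : (a + b) * (c * (1 - a * b)) >= (a + b) * (c * (1 / 2)).
  by rewrite !ler_wpM2l //; lra.
have : 0 <= c * (a + b) by rewrite mulr_ge0 //; lra.
by lra.
Qed.

(** * Local convergence of the signal product *)

Let e : R := 1 - a * b.
Let e' : R := 1 - a' * b'.

(** The next error has the form [e k + r]: [k] is the multiplier, equal to [1 - c (a^2 + b^2)] up to
    second order, and [r] is the forcing by the orthogonal components. *)
Let k : R := 1 - c * (a ^+ 2 + b ^+ 2) - c ^+ 2 * (a * b) * e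
              + c ^+ 2 * (p * b ^+ 2 + q * a ^+ 2).
Let r : R := c * (a * b) * (p + q) - c ^+ 2 * (p * q) * (a * b).

Lemma error_step : e' = e * k + r.
Proof. by rewrite /k /r /e' /e /a' /b' /U /V; ring. Qed.

(** The contraction comes from [a^2 + b^2 >= 2 a b >= 1], so the leading part of [k] is at most
    [1 - c]; the terms in [c^2] cost at most [3 c / 100]. *)
Let local_bounds : 1 / 2 <= a * b ->
  [/\ -1 <= e <= 1 / 2,
      0 <= k <= 1 - c / 2
   & 0 <= r <= 2 * c * (p + q)].
Proof.
move=> hab; case: bounds => /andP[cp cs] [U0 V0] hS _ _; case: B => [[a0 b0]] [p0 q0 w1] _ _ _.
have hs : a ^+ 2 + b ^+ 2 <= 4 by move: hS; rewrite /U /V; lra.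
have hs1 : 1 <= a ^+ 2 + b ^+ 2 by have := sqr_ge0 (a - b); rewrite !expr2; lra.
have ab2 : a * b <= 2 by have := sqr_ge0 (a - b); rewrite expr2; rewrite !expr2 in hs; lra.
have he : -1 <= e <= 1 / 2 by apply/andP; split; rewrite /e; lra.
have c20 : 0 <= c ^+ 2 by rewrite sqr_ge0.
have c2 : c ^+ 2 <= c / 100 by rewrite expr2; nra.
have z1 : -2 <= (a * b) * e <= 1 by move/andP: he => [? ?]; apply/andP; split; nra.
have z2 : 0 <= p * b ^+ 2 + q * a ^+ 2 <= 1.
  apply/andP; split; first by rewrite addr_ge0 // mulr_ge0 ?sqr_ge0.
  have := sqr_ge0 a; have := sqr_ge0 b; nra.
split => //.
- rewrite /k -(mulrA (c ^+ 2)); move/andP: z1 => [z11 z12]; move/andP: z2 => [z21 z22].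
  have y1 : c ^+ 2 * (-2) <= c ^+ 2 * (a * b * e) by apply: ler_wpM2l.
  have y2 : c ^+ 2 * (a * b * e) <= c ^+ 2 * 1 by apply: ler_wpM2l.
  have y3 : 0 <= c ^+ 2 * (p * b ^+ 2 + q * a ^+ 2) by rewrite mulr_ge0.
  have y4 : c ^+ 2 * (p * b ^+ 2 + q * a ^+ 2) <= c ^+ 2 * 1 by apply: ler_wpM2l.
  have y5 : c * (a ^+ 2 + b ^+ 2) <= c * 4 by apply: ler_wpM2l => //; lra.
  have y6 : c * 1 <= c * (a ^+ 2 + b ^+ 2) by apply: ler_wpM2l => //; lra.
  by apply/andP; split; lra.
- have pq : p * q <= p + q by nra.
  have pq0 : 0 <= p * q by rewrite mulr_ge0.
  have -> : r =
    c * ((a * b) * ((p + q) - c * (p * q))) by rewrite /r; ring.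
  have k0 : 0 <= p + q - c * (p * q) <= p + q by apply/andP; split; nra.
  move/andP: k0 => [k1 k2].
  apply/andP; split; first by rewrite !mulr_ge0 //; lra.
  have -> : 2 * c * (p + q) = c * (2 * (p + q)) by ring.
  apply: ler_wpM2l; first lra.
  by apply: ler_pM => //; lra.
Qed.

(** Multiplication by [k] takes an error of at most [1/2] down by [c / 4], while the forcing brings
    back at most [2 c / 100]. *)
Lemma product_ge_half : 1 / 2 <= a * b -> 1 / 2 <= a' * b'.
Proof.
move=> hab; case: (local_bounds hab); have := error_step.
move=> he' /andP[e1 e2] /andP[k0 k1] /andP[r0 r1].
have [/andP[cp cs] _ _ _ _] := bounds.
have w1 : p + q <= 1 / 100 by case: B => _ [].
have : e' <= 1 / 2.
  rewrite he'.
  have h1 : e * k <= 1 / 2 * k by apply: ler_wpM2r.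
  have : 2 * c * (p + q) <= 2 * c * (1 / 100) by apply: ler_wpM2l => //; lra.
  by lra.
by rewrite /e'; lra.
Qed.

(** The term [16 (p + q)] loses [4 c (p + q)]: half of this pays for the forcing of the signal
    error, and the other half is [c / 8] of the term itself. This balance fixes the weight [16] and
    the rate. *)
Lemma potential_contraction : 1 / 2 <= a * b ->
  `|1 - a' * b'| + 16 * (p' + q') <= (1 - c / 8) * (`|1 - a * b| + 16 * (p + q)).
Proof.
move=> hab; case: (local_bounds hab); rewrite -/e -/e'; have := error_step.
move=> -> _ /andP[k0 k1] /andP[r0 r1].
have [/andP[cp cs] _ _ _ _] := bounds.
have hw := basin_perp_contraction hab.
have [p0 q0] : 0 <= p /\ 0 <= q by case: B => _ [].
have h : `|e * k + r| <= `|e| * (1 - c / 2) + 2 * c * (p + q).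
  apply: (le_trans (ler_normD _ _)); rewrite normrM (ger0_norm k0) (ger0_norm r0).
  by apply: lerD => //; apply: ler_wpM2l.
have e0 : 0 <= c * `|e| by rewrite mulr_ge0 //; lra.
have : 0 <= c * (p + q) by rewrite mulr_ge0 //; lra.
by lra.
Qed.

Lemma loss_le_potential : 1 / 2 <= a * b ->
  F <= `|1 - a * b| + 16 * (p + q) /\ `|1 - a * b| + 16 * (p + q) <= 2.
Proof.
move=> hab; case: (local_bounds hab); rewrite -/e => /andP[e1 e2] _ _.
case: bounds => /andP[cp cs] [U0 V0] hS _ _; case: B => [[a0 b0]] [p0 q0 w1] _ _ _.
have he : `|e| <= 1 by rewrite ler_norml e1 /=; lra.
split; last lra.
rewrite loss_decomp -/e.
have h1 : e ^+ 2 <= `|e|.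
  by rewrite -real_normK ?num_real // expr2 -[leRHS]mulr1 ler_wpM2l.
have a2 : a ^+ 2 <= 4 by move: hS; rewrite /U /V; have := sqr_ge0 b; lra.
have b2 : b ^+ 2 <= 4 by move: hS; rewrite /U /V; have := sqr_ge0 a; lra.
have : a ^+ 2 * q <= 4 * q by apply: ler_wpM2r.
have : p * b ^+ 2 <= p * 4 by apply: ler_wpM2l.
have : p * q <= p by nra.
by lra.
Qed.

End Step.

(** * Trajectories *)

Lemma half_split t : (t = t./2 + (t - t./2))%N /\ (t./2 <= t - t./2)%N.
Proof. by have := odd_double_half t; rewrite -addnn; split; lia. Qed.

Section Trajectory.
Variables (R : realType) (c : R) (a b p q : nat -> R).
Hypotheses (c0 : 0 < c) (c1 : c <= 1 / 100).
Hypothesis aS : forall t, a t.+1 = (1 - c * (b t ^+ 2 + q t)) * a t + c * b t.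
Hypothesis bS : forall t, b t.+1 = (1 - c * (a t ^+ 2 + p t)) * b t + c * a t.
Hypothesis pS : forall t, p t.+1 = (1 - c * (b t ^+ 2 + q t)) ^+ 2 * p t.
Hypothesis qS : forall t, q t.+1 = (1 - c * (a t ^+ 2 + p t)) ^+ 2 * q t.
Hypothesis B0 : basin c (a 0%N) (b 0%N) (p 0%N) (q 0%N).

Lemma basin_trajectory t : basin c (a t) (b t) (p t) (q t).
Proof.
by elim: t => // t IH; rewrite aS bS pS qS; exact: basin_step.
Qed.

Lemma product_ge_half_trajectory n m :
  1 / 2 <= a n * b n -> 1 / 2 <= a (n + m)%N * b (n + m)%N.
Proof.
move=> h; elim: m => [|m IH]; first by rewrite addn0.
rewrite addnS aS bS; apply: product_ge_half => //; exact: basin_trajectory.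
Qed.

(** If the product were still below [1/2] at time [n], it would have been at most [1/2] at all
    earlier times, as that threshold is never recrossed downwards. The sum would then have grown
    geometrically past [3], against [a^2 + b^2 <= 4]. *)
Lemma product_reaches_half n :
  3 < (1 + c / 4) ^+ n * (a 0%N + b 0%N) -> 1 / 2 <= a n * b n.
Proof.
move=> hn; rewrite leNgt; apply/negP => hlt.
have small k : (k <= n)%N -> a k * b k <= 1 / 2.
  move=> kn; rewrite leNgt; apply/negP => hk.
  have := product_ge_half_trajectory (n - k) (ltW hk).
  by rewrite subnKC //; lra.
have grow k : (k <= n)%N -> (1 + c / 4) ^+ k * (a 0%N + b 0%N) <= a k + b k.
  elim: k => [|k IH] kn; first by rewrite expr0 mul1r.
  rewrite exprS -mulrA aS bS.
  apply: le_trans (sum_growth c0 c1 (basin_trajectory k) (small _ (ltnW kn))).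
  by apply: ler_wpM2l; [have := c0; lra|exact: IH (ltnW kn)].
case: (basin_trajectory n) => [[an bn]] [pn qn _] _ _ hS.
have := grow n (leqnn n).
have h4 : a n ^+ 2 + b n ^+ 2 <= 4 by lra.
have : a n + b n <= 3 by have := sqr_ge0 (a n - b n); rewrite !expr2 in h4 *; nra.
by lra.
Qed.

Lemma loss_decay n m : 1 / 2 <= a n * b n ->
  (a (n + m)%N ^+ 2 + p (n + m)%N) * (b (n + m)%N ^+ 2 + q (n + m)%N)
    - 2 * (a (n + m)%N * b (n + m)%N) + 1 <= 2 * (1 - c / 8) ^+ m.
Proof.
move=> hn.
have [h1 h2] := loss_le_potential c0 c1 (basin_trajectory (n + m)) (product_ge_half_trajectory m hn).
apply: le_trans h1 _ => {h2}.
elim: m => [|m IH].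
  have [_] := loss_le_potential c0 c1 (basin_trajectory n) hn.
  by rewrite addn0 expr0 mulr1.
rewrite addnS aS bS pS qS.
have := potential_contraction c0 c1 (basin_trajectory (n + m)) (product_ge_half_trajectory m hn).
move=> /le_trans; apply; rewrite exprS mulrCA; apply: ler_wpM2l => //.
by have := c0; have := c1; lra.
Qed.

Lemma loss_bound (d kappa eps : R) (t : nat) : 1 <= d -> 0 < kappa -> 0 < eps < 1 ->
  kappa / d <= a 0%N + b 0%N ->
  (16 / c * (2 + `|ln (6 / kappa)|) + 1) * (ln (d / eps) + 1) <= t%:R ->
  (a t ^+ 2 + p t) * (b t ^+ 2 + q t) - 2 * (a t * b t) + 1 <= eps ^+ 2.
Proof.
move=> d1 k0 /andP[e0 e1] hs ht.
have d0 : 0 < d by lra.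
have cp := c0; have cs := c1.
set A := `|ln (6 / kappa)| in ht.
have A0 : 0 <= A by exact: normr_ge0.
have ld : 0 <= ln d by rewrite ln_ge0.
have le : ln eps < 0 by rewrite ln_lt0 // e0.
rewrite ln_div ?posrE // in ht.
have ht2 : 16 / c * (2 * (ln d - ln eps) + 2 + A) + 1 <= t%:R.
  apply: le_trans ht; rewrite mulrDl mul1r.
  have ic : 0 <= 16 / c by rewrite divr_ge0 //; lra.
  have : 16 / c * (2 * (ln d - ln eps) + 2 + A) <= 16 / c * ((2 + A) * (ln d - ln eps + 1)).
    by apply: ler_wpM2l => //; nra.
  by lra.
(* The first half of the time is for growth, the second for decay; the same lower bound serves both.
   The summand [1] in the time bound absorbs the parity of [t]. *)
pose n := t./2; pose m := (t - n)%N.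
have [nm mn] : t = (n + m)%N /\ (n <= m)%N := half_split t.
have hn : 8 / c * (2 * (ln d - ln eps) + 2 + A) <= n%:R.
  have : t%:R <= 1 + 2 * n%:R :> R.
    rewrite -[t in t%:R]odd_double_half natrD -mul2n natrM lerD2r.
    by case: (odd t).
  by lra.
have hm : 8 / c * (2 * (ln d - ln eps) + 2 + A) <= m%:R.
  by apply: (le_trans hn); rewrite ler_nat.
have cancel (x y : R) : 8 / c * x <= y -> x <= c / 8 * y.
  move=> h; have -> : x = c / 8 * (8 / c * x) by field; lra.
  by apply: ler_wpM2l => //; lra.
move/cancel: hn => hn; move/cancel: hm => hm.
rewrite nm; apply: le_trans (loss_decay _ _) _.
  apply: product_reaches_half.
  (* Follows from [expR (- c / 8) >= 1 - c / 8] and [(1 - c / 8) (1 + c / 4) >= 1]. *)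
  have h1 : expR (c / 8) <= 1 + c / 4.
    have h2 : 1 - c / 8 <= expR (- (c / 8)) by rewrite -[- (c / 8)]/(- (c / 8)) expR_ge1Dx.
    have h3 : expR (c / 8) * expR (- (c / 8)) = 1 by rewrite -expRD subrr expR0.
    have := expR_gt0 (c / 8); nra.
  have h2 : expR (c / 8 * n%:R) <= (1 + c / 4) ^+ n.
    rewrite expRM_natr; apply: lerXn2r => //; rewrite nnegrE; first exact: expR_ge0.
    by lra.
  have h3 : 6 / kappa * d <= expR (c / 8 * n%:R).
    have -> : 6 / kappa * d = expR (ln (6 / kappa) + ln d).
      by rewrite expRD !lnK ?posrE // divr_gt0.
    rewrite ler_expR; apply: le_trans hn.
    have : ln (6 / kappa) <= A by exact: ler_norm.
    by lra.
  have h4 : 6 <= (1 + c / 4) ^+ n * (kappa / d).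
    have -> : 6 = 6 / kappa * d * (kappa / d) :> R by field; lra.
    apply: ler_wpM2r; first by rewrite divr_ge0 // ltW.
    exact: le_trans h3 h2.
  have : (1 + c / 4) ^+ n * (kappa / d) <= (1 + c / 4) ^+ n * (a 0%N + b 0%N).
    by apply: ler_wpM2l => //; rewrite exprn_ge0 //; lra.
  by lra.
have h1 : (1 - c / 8) ^+ m <= expR (- (c / 8 * m%:R)).
  rewrite -(mulNr (c / 8)) expRM_natr; apply: lerXn2r; rewrite ?nnegrE ?expR_ge0 //; first lra.
  exact: expR_ge1Dx.
(* The extra [- 1] yields a factor [1 / e <= 1/2], which cancels the prefactor [2] of
   [loss_decay]. *)
have h2 : expR (- (c / 8 * m%:R)) <= expR (- 1 + ln eps * 2%:R).
  by rewrite ler_expR; lra.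
have h3 : expR (- 1 + ln eps * 2%:R) = (expR 1)^-1 * eps ^+ 2.
  by rewrite expRD expRN expRM_natr lnK ?posrE.
have h4 : (expR 1)^-1 <= 1 / 2 :> R.
  rewrite div1r lef_pV2 ?posrE ?expR_gt0 //.
  by apply: le_trans (expR_ge1Dx 1); lra.
have : (expR 1)^-1 * eps ^+ 2 <= 1 / 2 * eps ^+ 2 by rewrite ler_wpM2r // sqr_ge0.
by lra.
Qed.

End Trajectory.

(** * Reduction of gradient descent to the scalar dynamics *)

Section Dotv.
Variables (R : realType) (n : nat).
Implicit Types (x y z : 'cV[R]_n).

Lemma dotvE x y : dotv x y = \sum_i x i 0 * y i 0.
Proof. by rewrite /dotv mxE; apply: eq_bigr => i _; rewrite mxE. Qed.

Lemma dotvC x y : dotv x y = dotv y x.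
Proof. by rewrite !dotvE; apply: eq_bigr => i _; rewrite mulrC. Qed.

Lemma dotvDZl k l x y z : dotv (k *: x + l *: y) z = k * dotv x z + l * dotv y z.
Proof.
by rewrite !dotvE !mulr_sumr -big_split; apply: eq_bigr => i _; rewrite !mxE /=; ring.
Qed.

Lemma dotvDZr k l x y z : dotv z (k *: x + l *: y) = k * dotv z x + l * dotv z y.
Proof. by rewrite dotvC dotvDZl !(dotvC z). Qed.

Lemma dotvv_ge0 x : 0 <= dotv x x.
Proof. by rewrite dotvE sumr_ge0 // => i _; rewrite -expr2 sqr_ge0. Qed.

(** Nonnegativity of the squared norm of [x - (x . y) y]; this gives [p, q >= 0]. *)
Lemma dotv_unit_le x y : unit_vec y -> dotv x y ^+ 2 <= dotv x x.
Proof.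
move=> hy; have := dotvv_ge0 (1 *: x + (- dotv x y) *: y).
by rewrite !(dotvDZl, dotvDZr) (dotvC y x) hy; lra.
Qed.

Lemma unit_vec_dim x : unit_vec x -> (0 < n)%N.
Proof.
rewrite /unit_vec dotvE lt0n => hx; apply/eqP => n0.
have : \sum_i x i 0 * x i 0 = 0 :> R.
  by rewrite big1 // => -[i hi]; exfalso; rewrite n0 in hi.
by move/eqP; rewrite hx oner_eq0.
Qed.

End Dotv.

Section GradientDescent.
Variables (R : realType) (d1 d2 : nat) (sigma : R).

Lemma tr_Mstar (us : 'cV[R]_d1) (vs : 'cV[R]_d2) :
  (Mstar sigma us vs)^T = Mstar sigma vs us.
Proof. by rewrite /Mstar linearZ /= trmx_mul trmxK. Qed.

Lemma frob_loss (us u : 'cV[R]_d1) (vs v : 'cV[R]_d2) :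
  unit_vec us -> unit_vec vs ->
  frob (u *m v^T - Mstar sigma us vs) =
  Num.sqrt (dotv u u * dotv v v - 2 * sigma * (dotv u us * dotv v vs) + sigma ^+ 2).
Proof.
rewrite /unit_vec !dotvE => hu hv; congr Num.sqrt.
transitivity (\sum_i \sum_j ((u i 0 * u i 0) * (v j 0 * v j 0)
   + (- (2 * sigma)) * ((u i 0 * us i 0) * (v j 0 * vs j 0))
   + sigma ^+ 2 * ((us i 0 * us i 0) * (vs j 0 * vs j 0)))).
  apply: eq_bigr => i _; apply: eq_bigr => j _.
  by rewrite !mxE !big_ord1 !mxE; ring.
under eq_bigr do rewrite !big_split /= -!mulr_sumr.
by rewrite !big_split /= -!mulr_suml -!mulr_sumr -!mulr_suml hu hv; ring.
Qed.

End GradientDescent.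

(** Rank one matrices applied to [v] return multiples of [u] and [us], so the scalar products close
    on themselves. Through [tr_Mstar] the same identity serves the update of [v]. *)
Lemma gd_half_step (R : realType) d1 d2 (eta sigma : R) (us u : 'cV[R]_d1) (vs v : 'cV[R]_d2) :
  u - eta *: ((u *m v^T - Mstar sigma us vs) *m v) =
  (1 - eta * dotv v v) *: u + (eta * sigma * dotv v vs) *: us.
Proof.
have mulv (x : 'cV[R]_d1) (y : 'cV[R]_d2) : x *m y^T *m v = dotv y v *: x.
  by rewrite -mulmxA [y^T *m v]mx11_scalar mul_mx_scalar.
rewrite mulmxBl /Mstar -scalemxAl !mulv (dotvC vs).
by apply/colP => i; rewrite !mxE; ring.
Qed.

(** The deterministic half of the theorem: randomness enters only through the bounds on [u0] and
    [v0]. The ratio [kappa / d] bounds the initial signal from below and costs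
    [ln (6 / kappa) + ln d] in the number of steps. *)
Lemma gd_convergence (R : realType) d1 d2 (c sigma delta d kappa : R)
  (us u0 : 'cV[R]_d1) (vs v0 : 'cV[R]_d2) :
  let iterate := gd_iter (c / sigma) (Mstar sigma us vs) u0 v0 in
  0 < c -> c <= 1 / 100 -> 0 < sigma -> unit_vec us -> unit_vec vs ->
  0 < delta -> 1 <= d -> 0 < kappa -> kappa / d <= delta / Num.sqrt sigma ->
  delta <= dotv u0 us <= 7 * delta -> delta <= dotv v0 vs <= 7 * delta ->
  dotv u0 u0 + dotv v0 v0 <= sigma / 100 ->
  (forall t, 1 / 7 <= `|dotv (iterate t).1 us| / `|dotv (iterate t).2 vs| <= 7) /\
  (forall (eps : R) (t : nat), 0 < eps < 1 ->
    (16 / c * (2 + `|ln (6 / kappa)|) + 1) * (ln (d / eps) + 1) <= t%:R ->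
    frob ((iterate t).1 *m (iterate t).2^T - Mstar sigma us vs) <= eps * sigma).
Proof.
move=> iterate c0 c1 s0 hu hv de0 d1' k0 hk /andP[u1 u2] /andP[v1 v2] hS.
set s := Num.sqrt sigma in hk.
have sp : 0 < s by rewrite sqrtr_gt0.
have s2 : s ^+ 2 = sigma by rewrite sqr_sqrtr // ltW.
pose a t := dotv (iterate t).1 us / s.
pose b t := dotv (iterate t).2 vs / s.
pose p t := dotv (iterate t).1 (iterate t).1 / sigma - a t ^+ 2.
pose q t := dotv (iterate t).2 (iterate t).2 / sigma - b t ^+ 2.
have sn : s != 0 by rewrite gt_eqF.
have iterS t : iterate t.+1 =
    ((1 - c / sigma * dotv (iterate t).2 (iterate t).2) *: (iterate t).1 + (c / sigma * sigma * dotv (iterate t).2 vs) *: us,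
     (1 - c / sigma * dotv (iterate t).1 (iterate t).1) *: (iterate t).2 + (c / sigma * sigma * dotv (iterate t).1 us) *: vs).
  rewrite {1}/iterate /gd_iter iterS -/(gd_iter _ _ _ _ _) -/(iterate t).
  by case: (iterate t) => u v /=; rewrite tr_Mstar !gd_half_step.
have aS t : a t.+1 = (1 - c * (b t ^+ 2 + q t)) * a t + c * b t.
  rewrite /a iterS /= dotvDZl hu /q /b -s2; field.
  exact: sn.
have bS t : b t.+1 = (1 - c * (a t ^+ 2 + p t)) * b t + c * a t.
  rewrite /b iterS /= dotvDZl hv /p /a -s2; field.
  exact: sn.
have pS t : p t.+1 = (1 - c * (b t ^+ 2 + q t)) ^+ 2 * p t.
  rewrite {1}/p aS iterS /= !(dotvDZl, dotvDZr) hu (dotvC us) /p /q /a /b -s2; field.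
  exact: sn.
have qS t : q t.+1 = (1 - c * (a t ^+ 2 + p t)) ^+ 2 * q t.
  rewrite {1}/q bS iterS /= !(dotvDZl, dotvDZr) hv (dotvC vs) /p /q /a /b -s2; field.
  exact: sn.
(* A start of total squared size at most [1/100] makes the size and imbalance conditions immediate;
   the cone holds since both signals lie in [[delta, 7 delta]]. *)
have B0 : basin c (a 0%N) (b 0%N) (p 0%N) (q 0%N).
  have p0 : 0 <= p 0%N.
    by rewrite /p /a exprMn exprVn s2 subr_ge0 ler_wpM2r ?dotv_unit_le // invr_ge0 ltW.
  have q0 : 0 <= q 0%N.
    by rewrite /q /b exprMn exprVn s2 subr_ge0 ler_wpM2r ?dotv_unit_le // invr_ge0 ltW.
  have hUV : a 0%N ^+ 2 + p 0%N + (b 0%N ^+ 2 + q 0%N) <= 1 / 100.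
    have -> : a 0%N ^+ 2 + p 0%N + (b 0%N ^+ 2 + q 0%N) = (dotv u0 u0 + dotv v0 v0) / sigma.
      by rewrite /p /q mulrDl; ring.
    by rewrite ler_pdivrMr //; lra.
  have hD : `|a 0%N ^+ 2 + p 0%N - (b 0%N ^+ 2 + q 0%N)| <= 1 / 100.
    have := sqr_ge0 (a 0%N); have := sqr_ge0 (b 0%N).
    by rewrite ler_norml => ? ?; apply/andP; split; lra.
  have hw : p 0%N + q 0%N <= 1 / 100.
    by have := sqr_ge0 (a 0%N); have := sqr_ge0 (b 0%N); lra.
  split.
  - by split; apply: divr_gt0 => //; lra.
  - by split.
  - split; rewrite mulrA; apply: ler_wpM2r; rewrite ?invr_ge0 ?(ltW sp) //.
      by rewrite /iterate /=; lra.
    by rewrite /iterate /=; lra.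
  - have : c * (p 0%N + q 0%N) <= 1 / 100 * (1 / 100) by apply: ler_pM => //; [exact: ltW|exact: addr_ge0].
    by lra.
  - by lra.
split=> [t|eps t he ht].
  have [[at0 bt0] _ [ab ba] _ _] := basin_trajectory c0 c1 aS bS pS qS B0 t.
  have aE : dotv (iterate t).1 us = a t * s by rewrite /a divfK.
  have bE : dotv (iterate t).2 vs = b t * s by rewrite /b divfK.
  have as0 : 0 < a t * s by exact: mulr_gt0.
  have bs0 : 0 < b t * s by exact: mulr_gt0.
  rewrite aE bE (gtr0_norm as0) (gtr0_norm bs0) -mulf_div divff // mulr1.
  by apply/andP; split; [rewrite ler_pdivlMr //|rewrite ler_pdivrMr //]; lra.
have hab : kappa / d <= a 0%N + b 0%N.
  apply: le_trans hk _; rewrite -mulrDl; apply: ler_wpM2r.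
    by rewrite invr_ge0 ltW.
  by rewrite /iterate /=; lra.
have := loss_bound c0 c1 aS bS pS qS B0 d1' k0 he hab ht.
have e0 : 0 < eps by case/andP: he.
rewrite frob_loss // => hF.
have -> : eps * sigma = Num.sqrt (eps ^+ 2 * sigma ^+ 2).
  by rewrite -exprMn sqrtr_sqr ger0_norm // mulr_ge0 ?ltW.
apply: ler_wsqrtr.
have -> : dotv (iterate t).1 (iterate t).1 * dotv (iterate t).2 (iterate t).2
    - 2 * sigma * (dotv (iterate t).1 us * dotv (iterate t).2 vs) + sigma ^+ 2
  = ((a t ^+ 2 + p t) * (b t ^+ 2 + q t) - 2 * (a t * b t) + 1) * sigma ^+ 2.
  by rewrite /p /q /a /b -s2; field.
by rewrite ler_wpM2r ?sqr_ge0.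
Qed.

(** * Exponential moments of independent Gaussians *)

Import HBNNSimple.

(** Extends a weighted law from indicators to nonnegative functions by simple approximation and
    monotone convergence. It is used with the other independent factors as weight, and with a
    density as weight and [X] the identity. *)
Lemma ge0_integral_weighted (R : realType) (d d' : measure_display)
  (T : measurableType d) (S : measurableType d')
  (P : {measure set T -> \bar R}) (mu : {measure set S -> \bar R})
  (X : T -> S) (g : T -> R) (k : R) :
  measurable_fun setT X -> measurable_fun setT g -> (forall w, 0 <= g w) -> 0 <= k ->
  (forall B, measurable B ->
     (\int[P]_w (\1_B (X w) * g w)%:E = k%:E * mu B)%E) ->
  forall f : S -> R, measurable_fun setT f -> (forall x, 0 <= f x) ->
  (\int[P]_w (f (X w) * g w)%:E = k%:E * \int[mu]_x (f x)%:E)%E.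
Proof.
move=> mX mg g0 k0 H f mf f0.
have mf' : measurable_fun setT (fun x => (f x)%:E) by exact/measurable_EFinP.
pose f_ := nnsfun_approx measurableT mf'.
have fcvg x : (EFin \o (fun n => f_ n x)) @ \oo --> (f x)%:E.
  by apply: (cvg_nnsfun_approx measurableT mf') => // y _; rewrite lee_fin.
have fnd n m x : (n <= m)%N -> f_ n x <= f_ m x.
  by move=> nm; exact/lefP/nd_nnsfun_approx.
have mfX n : measurable_fun setT (fun w => f_ n (X w)).
  by apply: (measurableT_comp _ mX).
transitivity (limn (fun n => \int[P]_w (f_ n (X w) * g w)%:E))%E.
  rewrite -monotone_convergence//.
  - apply: eq_integral => w _; apply/esym/cvg_lim => //.
    under eq_fun do rewrite EFinM.
    rewrite EFinM; apply: cvgeZr => //.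
    exact: fcvg.
  - by move=> n; apply/measurable_EFinP/measurable_funM.
  - by move=> n w _; rewrite lee_fin mulr_ge0.
  - by move=> w _ m n mn; rewrite lee_fin ler_wpM2r// fnd.
transitivity (limn (fun n => k%:E * \int[mu]_x (f_ n x)%:E))%E; last first.
  apply/cvg_lim => //; apply: cvgeZl => //.
  have -> : (\int[mu]_x (f x)%:E = \int[mu]_x limn (fun n => (f_ n x)%:E))%E.
    by apply: eq_integral => x _; apply/esym/cvg_lim => //; exact: fcvg.
  apply: cvg_monotone_convergence => //.
  - by move=> n; exact/measurable_EFinP.
  - by move=> n x _; rewrite lee_fin.
  - by move=> x _ m n mn; rewrite lee_fin fnd.
congr (limn _); apply/funext => n.
transitivity (\sum_(r \in range (f_ n))
   (\int[P]_w (r%:E * (\1_(f_ n @^-1` [set r]) (X w) * g w)%:E)))%E.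
  rewrite -ge0_integral_fsum//.
  - apply: eq_integral => w _.
    under eq_fsbigr do rewrite -EFinM mulrA.
    by rewrite fsumEFin// -mulr_fsuml -fimfunE.
  - move=> r; apply: measurable_funeM; apply/measurable_EFinP/measurable_funM => //.
    by apply: (measurableT_comp _ mX); exact: measurable_indic.
  - move=> r w _; rewrite -EFinM mulrA EFinM mule_ge0 ?lee_fin//.
    exact: (nnfun_muleindic_ge0 (f_ n) r (X w)).
rewrite integral_nnsfun// sintegralE patch_setT ge0_mule_fsumr; last first.
  move=> r; have [r0|r0] := leP 0 r; first by rewrite mule_ge0.
  by rewrite preimage_nnfun0// measure0 mule0.
apply: eq_fsbigr => r _.
(* A nonnegative simple function has empty preimage at a negative [r], so both sides vanish
   there. *)
have [r0|r0] := leP 0 r; last first.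
  rewrite preimage_nnfun0// measure0 !mule0 integral0_eq// => w _.
  by rewrite indic0 mul0r mule0.
rewrite ge0_integralZl_EFin//.
- by rewrite H// muleCA.
- by move=> w _; rewrite lee_fin mulr_ge0.
- apply/measurable_EFinP/measurable_funM => //.
  by apply: (measurableT_comp _ mX); exact: measurable_indic.
Qed.

Section Independence.
Context {R : realType} {d : measure_display} {T : measurableType d}.
Variables (P : probability T R) (I : finType) (X : I -> T -> R).
Hypothesis mX : forall i, measurable_fun setT (X i).

Lemma prod_indicE (B : I -> set R) w :
  \prod_i \1_(B i) (X i w) = \1_(\bigcap_(i in [set: I]) (X i @^-1` B i)) w :> R.
Proof.
have [h|/existsNP[i hi]] := pselect (forall i, B i (X i w)).
  have hw : (\bigcap_(i in [set: I]) (X i @^-1` B i)) w by move=> i _; exact: h.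
  rewrite indicE (mem_set hw) big1 // => i _.
  by rewrite indicE (mem_set (h i)).
have hw : ~ (\bigcap_(i in [set: I]) (X i @^-1` B i)) w by move=> h; exact: hi (h i Logic.I).
by rewrite (bigD1 i) //= !indicE (memNset hi) mul0r (memNset hw).
Qed.

(** Indicators are exchanged for the functions [f i] one coordinate at a time: [s] lists the
    coordinates already exchanged, and for empty [s] the claim is independence itself. *)
Lemma independent_prod_expectation (mu : I -> {measure set (measurableTypeR R) -> \bar R})
  (f : I -> R -> R) (m : I -> R) :
  mutually_independent P X ->
  (forall i B, measurable B -> P (X i @^-1` B) = mu i B) ->
  (forall i, measurable_fun setT (f i)) -> (forall i x, 0 <= f i x) ->
  (forall i, (\int[mu i]_x (f i x)%:E = (m i)%:E)%E) ->
  (\int[P]_w (\prod_i f i (X i w))%:E = (\prod_i m i)%:E)%E.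
Proof.
move=> indep law mf f0 hm.
have m0 i : 0 <= m i.
  by rewrite -lee_fin -hm; apply: integral_ge0 => x _; rewrite lee_fin.
have muE i B : measurable B -> mu i B = (fine (mu i B))%:E.
  by move=> mB; rewrite fineK // -law // fin_num_measure // -[_ @^-1` _]setTI; exact: mX.
pose F (s : seq I) (B : I -> set R) i x := if i \in s then f i x else \1_(B i) x.
pose G (s : seq I) (B : I -> set R) i := if i \in s then m i else fine (mu i (B i)).
suff H : forall s B, (forall i, measurable (B i)) ->
    (\int[P]_w (\prod_i F s B i (X i w))%:E = (\prod_i G s B i)%:E)%E.
  have := H (enum I) (fun=> setT) (fun=> measurableT).
  under eq_integral do under eq_bigr do rewrite /F mem_enum.
  by move=> ->; congr EFin; apply: eq_bigr => i _; rewrite /G mem_enum.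
have F0 s B i x : 0 <= F s B i x.
  by rewrite /F; case: ifP.
have mF s B i : measurable (B i) -> measurable_fun setT (F s B i).
  move=> mB; rewrite /F; case: (i \in s); [exact: mf|exact: measurable_indic].
elim=> [|i s IH] B mB.
  under eq_integral do rewrite (prod_indicE B).
  have mI : measurable (\bigcap_(i in [set: I]) (X i @^-1` B i)).
    apply: fin_bigcap_measurable => // i _.
    by rewrite -[_ @^-1` _]setTI; exact: mX.
  rewrite integral_indic // setIT; apply: etrans (indep B mB) _; rewrite -prodEFin.
  by apply: eq_bigr => i _; rewrite /G in_nil -(muE i _ (mB i)); exact: law.
have [si|si] := boolP (i \in s).
  have sE j : (j \in i :: s) = (j \in s).
    by rewrite inE; case: eqVneq => // ->.
  under eq_integral do under eq_bigr do rewrite /F sE.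
  rewrite IH //; congr EFin; apply: eq_bigr => j _; by rewrite /G sE.
pose g w := \prod_(j | j != i) F s B j (X j w).
pose k := \prod_(j | j != i) G s B j.
have k0 : 0 <= k.
  by apply: prodr_ge0 => j _; rewrite /G; case: ifP => // _; exact: fine_ge0.
have g0 w : 0 <= g w by apply: prodr_ge0.
have mg : measurable_fun setT g.
  have -> : g = fun w => \prod_(j <- [seq j <- index_enum I | j != i]) F s B j (X j w).
    by apply/funext => w; rewrite big_filter.
  apply: measurable_prod => j _.
  exact: (measurableT_comp (mF s B j (mB j)) (mX j)).
(* The induction hypothesis holds for every family [B], so [B i] may be replaced by an arbitrary
   [C]; this gives the law of [X i] under the weight [g]. *)
have image C : measurable C -> (\int[P]_w (\1_C (X i w) * g w)%:E = k%:E * mu i C)%E.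
  move=> mC; pose B' j := if j == i then C else B j.
  have mB' j : measurable (B' j) by rewrite /B'; case: ifP.
  transitivity (\int[P]_w (\prod_j F s B' j (X j w))%:E)%E.
    apply: eq_integral => w _; congr EFin; rewrite (bigD1 i) //= {1}/F (negbTE si) /B' eqxx.
    by congr (_ * _); apply: eq_bigr => j ji; rewrite /F (negbTE ji).
  rewrite IH // (bigD1 i) //= {1}/G (negbTE si) /B' eqxx EFinM -(muE i _ mC) muleC; congr (_%:E * _)%E.
  by apply: eq_bigr => j ji; rewrite /G (negbTE ji).
transitivity (\int[P]_w (f i (X i w) * g w)%:E)%E.
  apply: eq_integral => w _; congr EFin; rewrite (bigD1 i) //= /F mem_head; congr (_ * _).
  by apply: eq_bigr => j ji; rewrite inE (negbTE ji).
rewrite (ge0_integral_weighted (mX i : measurable_fun setT (X i : T -> measurableTypeR R)) mg g0 k0 image (mf i) (f0 i)).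
rewrite hm -EFinM; congr EFin; rewrite (bigD1 i) //= mulrC {1}/G mem_head; congr (_ * _).
by apply: eq_bigr => j ji; rewrite /G inE (negbTE ji).
Qed.

End Independence.

(** Completing the square: the exponential times the centred density is a constant times the density
    with mean [w s^2]. Here [s] is the standard deviation. *)
Lemma normal_mgf (R : realType) (s w : R) : s != 0 ->
  (\int[normal_prob 0 s]_x (expR (w * x))%:E = (expR (w ^+ 2 * s ^+ 2 / 2))%:E)%E.
Proof.
move=> s0.
have mE : measurable_fun [set: R] (fun x => expR (w * x)).
  by apply: measurableT_comp => //; exact: measurable_funM.
have := @ge0_integral_weighted R _ _ _ _ lebesgue_measure (normal_prob 0 s) id
  (normal_pdf 0 s) 1 (@measurable_id _ _ _) (measurable_normal_pdf 0 s) (normal_pdf_ge0 0 s) ler01.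
move=> /(_ _ _ mE (fun=> expR_ge0 _)); rewrite mul1e => <-; last first.
  move=> B mB; rewrite mul1e /normal_prob [RHS]integral_mkcond.
  apply: eq_integral => x _; rewrite patchE indicE.
  by case: ifP => _; rewrite ?mul1r ?mul0r.
transitivity (\int[lebesgue_measure]_x ((expR (w ^+ 2 * s ^+ 2 / 2))%:E * (normal_pdf (w * s ^+ 2) s x)%:E))%E.
  apply: eq_integral => x _; rewrite -EFinM !normal_pdfE //; congr EFin.
  rewrite mulrCA [RHS]mulrCA; congr (_ * _); rewrite /normal_fun -!expRD; congr expR.
  by field.
rewrite ge0_integralZl_EFin ?expR_ge0 //.
- by rewrite integral_normal_pdf mule1.
- by move=> x _; rewrite lee_fin normal_pdf_ge0.
- by apply/measurable_EFinP; exact: measurable_normal_pdf.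
Qed.

Lemma gaussian_vector_mgf (R : realType) (d : measure_display) (T : measurableType d)
  (P : probability T R) (I : finType) (X : I -> T -> R) (s : R) (w : I -> R) :
  s != 0 -> (forall i, measurable_fun setT (X i)) -> mutually_independent P X ->
  (forall i B, measurable B -> P (X i @^-1` B) = normal_prob 0 s B) ->
  (\int[P]_t (expR (\sum_i w i * (X i t / s)))%:E = (expR ((\sum_i w i ^+ 2) / 2))%:E)%E.
Proof.
move=> s0 mX indep law.
under eq_integral => t _.
  rewrite expR_sum; under eq_bigr do rewrite mulrA mulrAC. over.
rewrite (@independent_prod_expectation _ _ _ P I X mX (fun=> normal_prob 0 s)
  (fun i x => expR (w i / s * x)) (fun i => expR (w i ^+ 2 / 2))) //.
- by rewrite -expR_sum mulr_suml.
- by move=> i; apply: measurableT_comp => //; exact: measurable_funM.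
- move=> i; rewrite normal_mgf //; congr (expR _)%:E.
  by field.
Qed.

(** * Probability of a good initialization *)

(** Bounds a squared norm by exponentials of linear forms, whose moments are known. *)
Lemma sqr_le_cosh (R : realType) (x : R) : x ^+ 2 <= 2 * (expR x + expR (- x)).
Proof.
have pos (y : R) : 0 <= y -> y ^+ 2 <= 2 * (expR y + expR (- y)).
  move=> y0; have := expR_ge1Dxn 1 y0; have := expR_gt0 (- y).
  by rewrite (_ : 2`!%:R = 2) //; lra.
have [|x0] := leP 0 x; first exact: pos.
by have := pos (- x); rewrite sqrrN opprK [expR (- x) + _]addrC; apply; lra.
Qed.

Section LinearExponentials.
Context {R : realType} {d : measure_display} {T : measurableType d}.
Variables (P : probability T R) (I : finType) (Z : I -> T -> R).
Hypothesis mZ : forall i, measurable_fun setT (Z i).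
Let lin (w : I -> R) t := \sum_i w i * Z i t.
Hypothesis mgf : forall w : I -> R,
  (\int[P]_t (expR (lin w t))%:E = (expR ((\sum_i w i ^+ 2) / 2))%:E)%E.

Let measurable_lin w : measurable_fun setT (lin w).
Proof. by apply: measurable_sum => i; exact: measurable_funM. Qed.

Let measurable_exp_lin w : measurable_fun setT (fun t => expR (lin w t)).
Proof. by apply: measurableT_comp => //; exact: measurable_lin. Qed.

(** Integrating a pointwise inequality between exponentials leaves a numerical inequality, from
    which a lower bound on [P G] can be solved. *)
Lemma mgf_domination (w0 : I -> R) (C : R) (G : set T) (J : finType) (c : J -> R)
  (w : J -> I -> R) :
  measurable G -> 0 <= C -> (forall j, 0 <= c j) ->
  (forall t, expR (lin w0 t) <= C * \1_G t + \sum_j c j * expR (lin (w j) t)) ->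
  expR ((\sum_i w0 i ^+ 2) / 2) <=
    C * fine (P G) + \sum_j c j * expR ((\sum_i w j i ^+ 2) / 2).
Proof.
move=> mG C0 c0 dom.
have m1 : measurable_fun [set: T] (fun t => \1_G t : R) by exact: measurable_indic.
have h : (\int[P]_t (expR (lin w0 t))%:E <=
  \int[P]_t ((C%:E * (\1_G t)%:E) + \sum_j (c j)%:E * (expR (lin (w j) t))%:E))%E.
  apply: ge0_le_integral => //.
  - by apply/measurable_EFinP; exact: measurable_exp_lin.
  - apply: emeasurable_funD; first by apply: measurable_funeM; exact/measurable_EFinP.
    apply: emeasurable_sum => j.
    by apply: measurable_funeM; apply/measurable_EFinP; exact: measurable_exp_lin.
  - move=> t _; rewrite (eq_bigr (fun j => (c j * expR (lin (w j) t))%:E)) => [|j _]; last by rewrite EFinM.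
    by rewrite sumEFin -EFinM -EFinD lee_fin.
have pge0 j t : (0 <= (c j)%:E * (expR (lin (w j) t))%:E)%E.
  by rewrite mule_ge0 // lee_fin // expR_ge0.
have mj j : measurable_fun setT (fun t => (c j)%:E * (expR (lin (w j) t))%:E)%E.
  by apply: measurable_funeM; apply/measurable_EFinP; exact: measurable_exp_lin.
move: h; rewrite mgf ge0_integralD //.
- rewrite ge0_integralZl_EFin //; last by exact/measurable_EFinP.
  have -> : (\int[P]_t (\1_G t)%:E = (fine (P G))%:E)%E.
    by rewrite integral_indic // setIT fineK // fin_num_measure.
  rewrite ge0_integral_sum //.
  rewrite (eq_bigr (fun j => (c j * expR ((\sum_i w j i ^+ 2) / 2))%:E)) => [|j _].
    by rewrite sumEFin -EFinM -EFinD lee_fin.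
  rewrite ge0_integralZl_EFin ?mgf ?EFinM //.
  by apply/measurable_EFinP; exact: measurable_exp_lin.
- by move=> t _; rewrite mule_ge0 // lee_fin.
- by apply: measurable_funeM; exact/measurable_EFinP.
- by move=> t _; apply: sume_ge0.
- exact: emeasurable_sum.
Qed.

Variables (alpha beta : I -> R).
Hypotheses (alpha1 : \sum_i alpha i ^+ 2 = 1) (beta1 : \sum_i beta i ^+ 2 = 1).
Hypothesis orth : \sum_i alpha i * beta i = 0.

(** The intervals have radius [3] around the tilted mean [4]. The last threshold is twice the bound
    [4 * expR (17 / 2) * #|I|] on the tilted mean of the cosh majorant, so Markov loses at most
    [1/2]. *)
Definition good_event : set T :=
  [set t | [/\ 1 <= lin alpha t <= 7, 1 <= lin beta t <= 7
             & \sum_i Z i t ^+ 2 <= 8 * expR (17 / 2) * #|I|%:R]].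

Lemma measurable_good_event : measurable good_event.
Proof.
have -> : good_event = (lin alpha @^-1` `[1, 7]) `&` (lin beta @^-1` `[1, 7]) `&`
    ((fun t => \sum_i Z i t ^+ 2) @^-1` `]-oo, 8 * expR (17 / 2) * #|I|%:R]).
  apply/seteqP; split => t /=; rewrite !in_itv /=; first by case=> ? ? ?; do 2?split.
  by case=> -[].
have pre (f : T -> R) (A : set R) : measurable_fun setT f -> measurable A -> measurable (f @^-1` A).
  by move=> mf mA; rewrite -[_ @^-1` _]setTI; exact: mf.
apply: measurableI; first by apply: measurableI; apply: (pre (lin _)).
apply: (pre (fun t => \sum_i Z i t ^+ 2)) => //.
by apply: measurable_sum => i; exact: measurable_funX.
Qed.

Let J : finType := ((bool * bool) + (bool * I))%type.

(* For [inl], the two Chernoff tilts of each linear form; for [inr], the two halves of cosh. *)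
Let gam (j : J) : I -> R :=
  match j with
  | inl (x, s) => fun i => (if s then -3 else 3) * (if x then alpha i else beta i)
  | inr (s, k) => fun i => (if s then 1 else -1) * (i == k)%:R
  end.

(** Normalized so that each term exceeds the base tilt on the failure it covers: [3 - 3 x >= 0] for
    [x <= 1] and [3 x - 21 >= 0] for [x >= 7]; the last coefficient is the inverse Markov
    threshold. *)
Let coef (j : J) : R :=
  match j with
  | inl (_, s) => expR (if s then 3 else -21)
  | inr _ => (4 * expR (17 / 2) * #|I|%:R)^-1
  end.

Let base i := 4 * alpha i + 4 * beta i.

Let norm_tilt (g : I -> R) : \sum_i (base i + g i) ^+ 2 =
  32 + 8 * (\sum_i alpha i * g i) + 8 * (\sum_i beta i * g i) + \sum_i g i ^+ 2.
Proof.
transitivity (16 * (\sum_i alpha i ^+ 2) + 16 * (\sum_i beta i ^+ 2)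
   + 32 * (\sum_i alpha i * beta i) + 8 * (\sum_i alpha i * g i)
   + 8 * (\sum_i beta i * g i) + \sum_i g i ^+ 2).
  by rewrite !mulr_sumr -!big_split /=; apply: eq_bigr => i _; rewrite /base; ring.
by rewrite alpha1 beta1 orth; lra.
Qed.

Let unit_coord_le (a : I -> R) k : \sum_i a i ^+ 2 = 1 -> -1 <= a k <= 1.
Proof.
move=> a1; have : a k ^+ 2 <= 1.
  by rewrite -a1 (bigD1 k) //= lerDl sumr_ge0 // => i _; rewrite sqr_ge0.
by rewrite expr2 => h; apply/andP; split; nra.
Qed.

(** One of the coordinates [(4, 4)] of the tilt becomes [1] or [7], and [(1 + 16) / 2 + 3 = (49 +
    16) / 2 - 21 = 23 / 2]. *)
Let norm_Chernoff x s : coef (inl (x, s)) * expR ((\sum_i (base i + gam (inl (x, s)) i) ^+ 2) / 2)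
  = expR (23 / 2).
Proof.
have sumg (a g : I -> R) (k : R) : \sum_i a i * (k * g i) = k * \sum_i a i * g i.
  by rewrite mulr_sumr; apply: eq_bigr => i _; ring.
have sq (g : I -> R) (k : R) : \sum_i (k * g i) ^+ 2 = k ^+ 2 * \sum_i g i ^+ 2.
  by rewrite mulr_sumr; apply: eq_bigr => i _; ring.
have orth' : \sum_i beta i * alpha i = 0.
  by rewrite -[RHS]orth; apply: eq_bigr => i _; rewrite mulrC.
have a1 : \sum_i alpha i * alpha i = 1 by rewrite -[RHS]alpha1; apply: eq_bigr => i _; rewrite expr2.
have b1 : \sum_i beta i * beta i = 1 by rewrite -[RHS]beta1; apply: eq_bigr => i _; rewrite expr2.
rewrite norm_tilt /= sq !sumg -expRD; congr expR.
by case: x; case: s => /=; rewrite ?a1 ?b1 ?orth ?orth' ?alpha1 ?beta1; field.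
Qed.

Let norm_coord s k : expR ((\sum_i (base i + gam (inr (s, k)) i) ^+ 2) / 2) <= expR (49 / 2).
Proof.
have pick (a : I -> R) (l : R) : \sum_i a i * (l * (i == k)%:R) = l * a k.
  rewrite (bigD1 k) //= big1 ?eqxx => [|i /negbTE ->]; first by rewrite addr0 mulr1 mulrC.
  by rewrite !mulr0.
have sq (l : R) : \sum_i (l * (i == k)%:R) ^+ 2 = l ^+ 2.
  rewrite (bigD1 k) //= big1 ?eqxx => [|i /negbTE ->]; first by rewrite addr0 mulr1.
  by rewrite mulr0 expr0n.
rewrite ler_expR norm_tilt /= sq !pick.
have /andP[? ?] := unit_coord_le k alpha1; have /andP[? ?] := unit_coord_le k beta1.
by case: s; rewrite ?sqrrN ?expr1n; lra.
Qed.

Hypothesis I0 : (0 < #|I|)%N.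

Let coef_ge0 j : 0 <= coef j.
Proof.
by case: j => [[x s]|[s k]] /=; rewrite ?expR_ge0 // invr_ge0 !mulr_ge0 ?expR_ge0.
Qed.

Let linD (f g : I -> R) t : lin (fun i => f i + g i) t = lin f t + lin g t.
Proof. by rewrite /lin -big_split /=; apply: eq_bigr => i _; rewrite mulrDl. Qed.

Let linZ k (f : I -> R) t : lin (fun i => k * f i) t = k * lin f t.
Proof. by rewrite /lin mulr_sumr; apply: eq_bigr => i _; rewrite mulrA. Qed.

Let lin_base t : lin base t = 4 * (lin alpha t + lin beta t).
Proof. by rewrite /base linD !linZ; ring. Qed.

Let domination t : expR (lin base t) <=
  expR 56 * \1_good_event t + \sum_j coef j * expR (lin (fun i => base i + gam j i) t).
Proof.
set S := \sum_j _.
have S0 j0 : coef j0 * expR (lin (fun i => base i + gam j0 i) t) <= S.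
  by rewrite /S (bigD1 j0) //= lerDl sumr_ge0 // => j _; rewrite mulr_ge0 ?expR_ge0.
have S00 : 0 <= S by rewrite sumr_ge0 // => j _; rewrite mulr_ge0 ?expR_ge0.
have ind0 : 0 <= expR 56 * \1_good_event t :> R by rewrite mulr_ge0 ?expR_ge0.
have [hG|hG] := pselect (good_event t).
  rewrite indicE (mem_set hG) mulr1; case: hG => /andP[_ ha] /andP[_ hb] _.
  by apply: ler_wpDr => //; rewrite ler_expR lin_base; lra.
apply: le_trans (_ : S <= _); last by rewrite lerDr.
have chern x s : 0 <= (if s then 3 else -21) + (if s then -3 else 3) * lin (if x then alpha else beta) t ->
    expR (lin base t) <= S.
  move=> h; apply: le_trans (S0 (inl (x, s))).
  have E : lin (gam (inl (x, s))) t = (if s then -3 else 3) * lin (if x then alpha else beta) t.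
    by rewrite -linZ; case: x {h}.
  by rewrite (linD base (gam (inl (x, s)))) E /coef -expRD ler_expR; lra.
have [a1|a1] := leP 1 (lin alpha t); last by apply: (chern true true); lra.
have [a7|a7] := leP (lin alpha t) 7; last by apply: (chern true false); lra.
have [b1|b1] := leP 1 (lin beta t); last by apply: (chern false true); lra.
have [b7|b7] := leP (lin beta t) 7; last by apply: (chern false false); lra.
have [hq|hq] := leP (\sum_i Z i t ^+ 2) (8 * expR (17 / 2) * #|I|%:R).
  by exfalso; apply: hG; split => //; apply/andP.
(* Only a large squared norm remains. The coordinate terms add up to the tilt times a quotient,
   which exceeds [1] by [sqr_le_cosh]. *)
have hS : (4 * expR (17 / 2) * #|I|%:R)^-1 * expR (lin base t) *
    (\sum_i (expR (Z i t) + expR (- Z i t))) <= S.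
  rewrite /S big_sumType /= -[leLHS]add0r; apply: lerD.
    by apply: sumr_ge0 => -[x s] _; rewrite mulr_ge0 ?expR_ge0.
  have -> : \sum_(x : bool * I) coef (inr x) * expR (lin (fun i => base i + gam (inr x) i) t) =
    \sum_(s : bool) \sum_(k : I) coef (inr (s, k)) * expR (lin (fun i => base i + gam (inr (s, k)) i) t).
    by rewrite pair_bigA; apply: eq_bigr => -[].
  rewrite big_bool /= -big_split /= mulr_sumr; apply: ler_sum => k _.
  have lk l : lin (fun i => base i + l * (i == k)%:R) t = lin base t + l * Z k t.
    rewrite linD linZ; congr (_ + _ * _).
    rewrite /lin (bigD1 k) //= eqxx mul1r big1 ?addr0 // => i /negbTE ->.
    by rewrite mul0r.
  by rewrite !lk !expRD mul1r mulN1r; lra.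
apply: le_trans hS.
have hq2 : \sum_i Z i t ^+ 2 <= 2 * (\sum_i (expR (Z i t) + expR (- Z i t))).
  by rewrite mulr_sumr; apply: ler_sum => i _; exact: sqr_le_cosh.
have kp : 0 < 4 * expR (17 / 2) * #|I|%:R :> R by rewrite !mulr_gt0 ?expR_gt0 ?ltr0n.
rewrite mulrAC -[leLHS]mul1r; apply: ler_wpM2r; first exact: expR_ge0.
by rewrite mulrC ler_pdivlMr // mul1r; lra.
Qed.

(** The tilt has total mass [expR 16]. The four Chernoff terms take at most a quarter of it and the
    coordinate terms at most half; the remaining quarter is at most [expR 56] times the
    probability. *)
Lemma good_event_prob : expR (-40) / 4 <= fine (P good_event).
Proof.
have := mgf_domination measurable_good_event (expR_ge0 56) coef_ge0 domination.
have -> : \sum_i base i ^+ 2 = 32.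
  transitivity (16 * (\sum_i alpha i ^+ 2) + 16 * (\sum_i beta i ^+ 2)
     + 32 * (\sum_i alpha i * beta i)); last by rewrite alpha1 beta1 orth; lra.
  by rewrite !mulr_sumr -!big_split /=; apply: eq_bigr => i _; rewrite /base; ring.
rewrite big_sumType /=.
have -> : \sum_(x : bool * bool) coef (inl x) * expR ((\sum_i (base i + gam (inl x) i) ^+ 2) / 2) = 4 * expR (23 / 2).
  rewrite (eq_bigr (fun=> expR (23 / 2))) => [|[x s] _]; last exact: norm_Chernoff.
  by rewrite sumr_const card_prod card_bool [RHS]mulr_natl.
set Q := \sum_(x : bool * I) _.
have hQ : Q <= expR 16 / 2.
  have -> : expR 16 / 2 = \sum_(x : bool * I) (4 * expR (17 / 2) * #|I|%:R)^-1 * expR (49 / 2) :> R.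
    have -> : 49 / 2 = 16 + 17 / 2 :> R by field.
    rewrite sumr_const card_prod card_bool -[RHS]mulr_natl natrM (expRD 16 (17 / 2)); field.
    by rewrite pnatr_eq0 -lt0n I0 gt_eqF // expR_gt0.
  apply: ler_sum => -[s k] _; apply: ler_wpM2l; first exact: (coef_ge0 (inr (s, k))).
  exact: norm_coord.
have e45 : 16 * expR (23 / 2) <= expR 16 :> R.
  have -> : expR 16 = expR 1 ^+ 4 * expR (1 / 2) * expR (23 / 2) :> R.
    by rewrite -expRM_natl -!expRD; congr expR; field.
  apply: ler_wpM2r; first exact: expR_ge0.
  have h2 : 2 <= expR 1 :> R by apply: le_trans (expR_ge1Dx 1); lra.
  have h4 : 16 <= expR 1 ^+ 4 :> R.
    have -> : 16 = 2 ^+ 4 :> R by ring.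
    by apply: lerXn2r => //; rewrite nnegrE //; lra.
  have h1 : 1 <= expR (1 / 2) :> R by rewrite -[leLHS]expR0 ler_expR; lra.
  by nra.
move=> h; have h56 : expR 56 = expR 16 * expR 40 :> R by rewrite -expRD; congr expR; ring.
rewrite (_ : 32 / 2 = 16) in h; last by field.
have e16 := expR_gt0 (16 : R); have e40 := expR_gt0 (40 : R).
set x := fine _ in h *.
have hx : 1 <= 4 * expR 40 * x by rewrite -(ler_pM2l e16); rewrite h56 in h; lra.
rewrite expRN ler_pdivrMr // -[leLHS]mul1r ler_pdivrMr //; lra.
Qed.

End LinearExponentials.

(** * Choice of constants and standardization of the initial vectors *)

Unset Implicit Arguments.

Theorem theorem3p2 (R : realType) :
  exists cinit0 cstep0 : R, 0 < cinit0 /\ 0 < cstep0 /\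
  forall cinit cstep : R, 0 < cinit -> cinit <= cinit0 ->
    0 < cstep -> cstep <= cstep0 ->
  exists p c0 C0 C : R, 0 < p /\ 0 < c0 /\ 0 < C0 /\ 0 < C /\
  forall (d1 d2 : nat) (sigma1 : R) (us : 'cV[R]_d1) (vs : 'cV[R]_d2),
    0 < sigma1 -> unit_vec us -> unit_vec vs ->
  let d := maxn d1 d2 in
  let delta := cinit * Num.sqrt (sigma1 / d%:R) in
  let eta := cstep / sigma1 in
  let M := Mstar sigma1 us vs in
  forall (dT : measure_display) (T : measurableType dT) (P : probability T R)
    (X : 'I_d1 -> {RV P >-> R}) (Y : 'I_d2 -> {RV P >-> R}),
    mutually_independent P (join_fam (fun i => (X i : T -> R))
                                     (fun j => (Y j : T -> R))) ->
    (forall i B, measurable B -> P (X i @^-1` B) = normal_prob 0 delta B) ->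
    (forall j B, measurable B -> P (Y j @^-1` B) = normal_prob 0 delta B) ->
  exists E : set T, measurable E /\ (p%:E <= P E)%E /\
  forall w, E w ->
    let u0 := \col_i X i w in
    let v0 := \col_j Y j w in
    (forall t : nat,
       let uv := gd_iter eta M u0 v0 t in
       c0 <= `|dotv uv.1 us| / `|dotv uv.2 vs| <= C0) /\
    (forall eps : R, 0 < eps < 1 ->
     forall t : nat, C * (ln (d%:R / eps) + 1) <= t%:R ->
       let uv := gd_iter eta M u0 v0 t in
       frob (uv.1 *m uv.2^T - M) <= eps * sigma1).
Proof.
(* On the good event the initial squared size is at most [16 expR (17 / 2) cinit^2 sigma1]; this
   bound on [cinit] brings it below [sigma1 / 100]. *)
exists (40 * expR (17 / 2))^-1, (1 / 100); split; first by rewrite invr_gt0 mulr_gt0 ?expR_gt0.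
split; first by lra.
move=> cinit cstep ci0 ci1 cs0 cs1.
exists (expR (- 40) / 4), (1 / 7), 7, (16 / cstep * (2 + `|ln (6 / cinit)|) + 1).
have cpos : 0 < 16 / cstep * (2 + `|ln (6 / cinit)|) + 1.
  have h : 0 < 16 / cstep by rewrite divr_gt0.
  have : 0 <= `|ln (6 / cinit)| by exact: normr_ge0.
  by move=> h1; rewrite addr_gt0 // mulr_gt0 //; lra.
have ppos : 0 < expR (- 40) / 4 :> R by rewrite divr_gt0 ?expR_gt0.
do 3 (split; first by [|lra]); split => // d1 d2 sigma1 us vs s0 hu hv d delta eta M dT T P X Y indep lawX lawY.
have d1pos : (0 < d1)%N := unit_vec_dim hu.
have dpos : (0 < d)%N by rewrite /d leq_max d1pos.
have d1R : 1 <= d%:R :> R by rewrite ler1n.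
have d0R : 0 < d%:R :> R by rewrite ltr0n.
have de0 : 0 < delta by rewrite mulr_gt0 // sqrtr_gt0 divr_gt0.
have de2 : delta ^+ 2 = cinit ^+ 2 * sigma1 / d%:R.
  by rewrite exprMn sqr_sqrtr ?mulrA // divr_ge0 // ltW.
pose I : finType := ('I_d1 + 'I_d2)%type.
pose W : I -> T -> R := join_fam (fun i => (X i : T -> R)) (fun j => (Y j : T -> R)).
pose Z (k : I) w := W k w / delta.
(* Extended by zero to the joint index set, the two target vectors become orthonormal. *)
pose alpha (k : I) : R := if k is inl i then us i 0 else 0.
pose beta (k : I) : R := if k is inr j then vs j 0 else 0.
have mW k : measurable_fun setT (W k) by case: k => k; exact: measurable_funPT.
have lawW k B : measurable B -> P (W k @^-1` B) = normal_prob 0 delta B.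
  by case: k => k; [exact: lawX|exact: lawY].
have mZ k : measurable_fun setT (Z k) by exact: measurable_funM.
have mgf w := gaussian_vector_mgf w (lt0r_neq0 de0) mW indep lawW.
have sqE n (x : 'cV[R]_n) : \sum_i x i 0 ^+ 2 = dotv x x.
  by rewrite dotvE; apply: eq_bigr => i _; rewrite expr2.
have alpha1 : \sum_k alpha k ^+ 2 = 1.
  by rewrite big_sumType /= sqE hu big1 ?addr0 // => j _; rewrite expr0n.
have beta1 : \sum_k beta k ^+ 2 = 1.
  by rewrite big_sumType /= sqE hv big1 ?add0r // => j _; rewrite expr0n.
have orth : \sum_k alpha k * beta k = 0.
  by rewrite big1 // => -[k|k] _; rewrite ?mulr0 ?mul0r.
have cardI : #|I| = (d1 + d2)%N by rewrite card_sum !card_ord.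
have I0 : (0 < #|I|)%N by rewrite cardI addn_gt0 d1pos.
have mG := measurable_good_event mZ alpha beta.
exists (good_event Z alpha beta); split => //; split.
  rewrite -[leRHS]fineK ?fin_num_measure // lee_fin.
  exact: (good_event_prob mZ mgf alpha1 beta1 orth I0).
move=> w [hA hB hS] u0 v0.
have linA : \sum_k alpha k * Z k w = dotv u0 us / delta.
  rewrite big_sumType /= [X in _ + X]big1 ?addr0 => [|j _]; last by rewrite mul0r.
  by rewrite dotvE mulr_suml; apply: eq_bigr => i _; rewrite mxE mulrCA mulrA.
have linB : \sum_k beta k * Z k w = dotv v0 vs / delta.
  rewrite big_sumType /= [X in X + _]big1 ?add0r => [|j _]; last by rewrite mul0r.
  by rewrite dotvE mulr_suml; apply: eq_bigr => i _; rewrite mxE mulrCA mulrA.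
have sqZ : \sum_k Z k w ^+ 2 = (dotv u0 u0 + dotv v0 v0) / delta ^+ 2.
  rewrite big_sumType /= !dotvE mulrDl !mulr_suml.
  by congr (_ + _); apply: eq_bigr => i _; rewrite mxE /Z exprMn exprVn expr2.
have range (x : R) : 1 <= x / delta <= 7 -> delta <= x <= 7 * delta.
  by rewrite ler_pdivlMr // ler_pdivrMr // mul1r.
rewrite linA in hA; rewrite linB in hB.
have hN : dotv u0 u0 + dotv v0 v0 <= sigma1 / 100.
  move: hS; rewrite sqZ ler_pdivrMr ?exprn_gt0 // => /le_trans; apply.
  have hI : #|I|%:R <= 2 * d%:R :> R.
    by rewrite cardI -natrM ler_nat mul2n -addnn leq_add // leq_max leqnn ?orbT.
  have e0 : 0 < expR (17 / 2) :> R by exact: expR_gt0.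
  have e1 : 1 <= expR (17 / 2) :> R by rewrite -[leLHS]expR0 ler_expR; lra.
  have hc : cinit * (40 * expR (17 / 2)) <= 1.
    by rewrite -ler_pdivlMr ?mulr_gt0 // div1r.
  apply: (@le_trans _ _ (8 * expR (17 / 2) * (2 * d%:R) * delta ^+ 2)).
    by apply: ler_wpM2r; [exact: sqr_ge0|apply: ler_wpM2l => //; rewrite mulr_ge0 // ltW].
  have -> : 8 * expR (17 / 2) * (2 * d%:R) * delta ^+ 2 = 16 * expR (17 / 2) * cinit ^+ 2 * sigma1.
    by rewrite de2; field; exact: lt0r_neq0.
  rewrite [leRHS]mulrC; apply: ler_wpM2r; first exact: ltW.
  have h1 : cinit <= 1 / 40.
    by rewrite -[leLHS]mulr1 ler_pdivlMr //; nra.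
  rewrite expr2.
  have : cinit * (40 * expR (17 / 2)) * cinit <= 1 * (1 / 40).
    by apply: ler_pM => //; rewrite ?mulr_ge0 // ltW.
  by lra.
(* Here [kappa] is [cinit]: the right side is [cinit] over the square root of [d], and [d >= 1]. *)
have hk : cinit / d%:R <= delta / Num.sqrt sigma1.
  have sp : 0 < Num.sqrt sigma1 by rewrite sqrtr_gt0.
  have -> : delta / Num.sqrt sigma1 = cinit * Num.sqrt d%:R^-1.
    by rewrite /delta sqrtrM ?(ltW s0) //; field; exact: lt0r_neq0.
  apply: ler_wpM2l; first exact: ltW.
  have y0 : 0 <= d%:R^-1 :> R by rewrite invr_ge0.
  have y1 : d%:R^-1 <= 1 :> R by rewrite invf_le1.
  rewrite -[leLHS]ger0_norm // -sqrtr_sqr; apply: ler_wsqrtr.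
  by rewrite expr2 -[leRHS]mulr1 ler_wpM2l.
have [h1 h2] := gd_convergence cs0 cs1 s0 hu hv de0 d1R ci0 hk (range _ hA) (range _ hB) hN.
by split => // eps he t ht; apply: h2.
Qed.
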